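(* Suppose that the algebra $\mathbf A$ has binary terms $\vee$ and $\wedge$ such that $\vee$ defines a join-semilattice operation on $\mathbf A$, the identities $a\wedge(a\vee b)=a$ and $(a\vee b)\wedge b=b$ are satisfied for all elements $a,b\in A$, and the semilattice order induced by $\vee$ (that is, $a\le b$ if and only if $a\vee b=b$) is a compatible relation on $\mathbf A$. Then all tolerances of $\mathbf A$ are representable. In particular, all tolerances in a lattice are representable.
   Context: A binary relation on (the universe $A$ of) an algebra $\mathbf A$ is compatible (also called admissible) if it is preserved by all basic operations of $\mathbf A$. A tolerance of $\mathbf A$ is a reflexive, symmetric, compatible binary relation on $\mathbf A$. For binary relations $R,S$ on $A$, $R\circ S=\{(x,y): \exists z\ (x,z)\in R,\ (z,y)\in S\}$, and $R^-$ denotes the converse of $R$. A tolerance $\Theta$ of $\mathbf A$ is representable if and only if there exists a compatible and reflexive relation $R$ on $\mathbf A$ such that $\Theta=R\circ R^-$. *)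

(* Defs.v *)
From Stdlib Require Export Relation_Definitions RelationClasses.
From mathcomp Require Export all_boot all_order.

Set Implicit Arguments.
Unset Strict Implicit.
Unset Printing Implicit Defensive.

(* Signatures are finitary and unrestricted otherwise: any type of operation
   symbols, any arities (including 0).  Carriers are arbitrary types. *)
Record signature := Signature {
  symbol :> Type;
  arity : symbol -> nat
}.

Record algebra (S : signature) := Algebra {
  carrier :> Type;
  interp : forall f : S, {ffun 'I_(arity f) -> carrier} -> carrier
}.

Inductive term (S : signature) (n : nat) :=
| Var of 'I_n
| App (f : S) of ('I_(arity f) -> term S n).

Fixpoint eval (S : signature) (A : algebra S) (n : nat) (v : 'I_n -> A)
    (t : term S n) : A :=
  match t with
  | Var i => v i
  | App f ts => interp (f := f) [ffun i => eval v (ts i)]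
  end.

Definition term_op2 (S : signature) (A : algebra S) (t : term S 2) :
    A -> A -> A :=
  fun a b => eval (tnth [tuple a; b]) t.

(* Binary relations are Prop-valued, [relation A := A -> A -> Prop]. *)
Definition compatible (S : signature) (A : algebra S) (R : relation A) : Prop :=
  forall (f : S) (x y : {ffun 'I_(arity f) -> A}),
    (forall i, R (x i) (y i)) -> R (interp x) (interp y).

Definition tolerance (S : signature) (A : algebra S) (T : relation A) : Prop :=
  [/\ Reflexive T, Symmetric T & compatible T].

Definition rel_comp (A : Type) (R S : relation A) : relation A :=
  fun x y => exists z, R x z /\ S z y.

Definition converse (A : Type) (R : relation A) : relation A :=
  fun x y => R y x.

(* Equality of relations is equality of their graphs. *)
Definition representable (S : signature) (A : algebra S) (T : relation A) :
    Prop :=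
  exists R : relation A,
    [/\ compatible R, Reflexive R &
        forall x y, T x y <-> rel_comp R (converse R) x y].

Definition semilattice_op (A : Type) (join : A -> A -> A) : Prop :=
  [/\ associative join, commutative join & idempotent_op join].

Definition join_le (A : Type) (join : A -> A -> A) : relation A :=
  fun a b => join a b = b.

(* Idempotency of both operations follows from absorption. *)
Definition is_lattice (L : Type) (join meet : L -> L -> L) : Prop :=
  [/\ associative join /\ commutative join,
      associative meet /\ commutative meet,
      (forall a b, join a (meet a b) = a) &
      (forall a b, meet a (join a b) = a)].

Variant lattice_symbol := Join | Meet.

Definition lattice_signature : signature :=
  @Signature lattice_symbol (fun _ => 2).

Definition lattice_algebra (L : Type) (join meet : L -> L -> L) :
    algebra lattice_signature :=
  @Algebra lattice_signature L (fun f (x : {ffun 'I_2 -> L}) =>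
    match f with
    | Join => join (x ord0) (x ord_max)
    | Meet => meet (x ord0) (x ord_max)
    end).

(* [is_lattice] asks for no decidable equality or choice on the carrier, so it
   covers the lattices of the library and more. *)
Import Order.LTheory.

Lemma latticeType_is_lattice d (L : latticeType d) :
  is_lattice (@Order.join d L) (@Order.meet d L).
Proof.
split; [split| split|..].
- exact: joinA.
- exact: joinC.
- exact: meetA.
- exact: meetC.
- by move=> a b; rewrite joinC meetUKC.
- by move=> a b; rewrite joinKI.
Qed.

(* Main.v *)
Require Import Defs.
From mathcomp Require Import all_boot all_order.

(** The representing relation is [R], the part of the tolerance [T] lying in
    the semilattice order: [x R z] iff [x <= z] and [x T z].  It is compatible
    because both [T] and the order are.

    If [x T y], joining with [x] on the left and with [y] on the right gives
    [x T x \/ y] and [x \/ y T y], so [x] and [y] have the common [R]-upper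
    bound [x \/ y].  Conversely, let [z] be a common [R]-upper bound of [x] and
    [y].  From [x T z] and [z T y] follows [x /\ z T z /\ y]; since [x <= z]
    and [y <= z], the two absorption identities evaluate the sides to [x] and
    [y], one identity for each side on which [z] occurs.

    In a lattice the order is compatible since join and meet are monotone, so
    the second claim is an instance of the first. *)

(** Term operations are composed of basic ones, so what the basic operations
    preserve the terms preserve too; this lets [T] be pushed through the join
    and meet terms. *)
Lemma compatible_eval (S : signature) (A : algebra S) (R : relation A)
    (n : nat) (t : term S n) (v w : 'I_n -> A) :
  compatible R -> (forall i, R (v i) (w i)) -> R (eval v t) (eval w t).
Proof.
move=> Rcomp Rvw; elim: t => [i | f ts IHts] /=; first exact: Rvw.
by apply: Rcomp => i; rewrite !ffunE; apply: IHts.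
Qed.

Lemma compatible_term_op2 (S : signature) (A : algebra S) (R : relation A)
    (t : term S 2) (a b c d : A) :
  compatible R -> R a c -> R b d -> R (term_op2 t a b) (term_op2 t c d).
Proof.
move=> Rcomp Rac Rbd; apply: compatible_eval => // i.
by case: i => [[|[|//]] ?]; rewrite !(tnth_nth a).
Qed.

Lemma compatible_inter (S : signature) (A : algebra S) (Q R : relation A) :
  compatible Q -> compatible R -> compatible (fun x y => Q x y /\ R x y).
Proof.
by move=> Qcomp Rcomp f x y QRxy; split;
  [apply: Qcomp | apply: Rcomp] => i; case: (QRxy i).
Qed.

Lemma tolerance_representable (S : signature) (A : algebra S)
    (tjoin tmeet : term S 2) :
  semilattice_op (term_op2 (A := A) tjoin) ->
  (forall a b : A, term_op2 tmeet a (term_op2 tjoin a b) = a) ->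
  (forall a b : A, term_op2 tmeet (term_op2 tjoin a b) b = b) ->
  compatible (join_le (term_op2 (A := A) tjoin)) ->
  forall T : relation A, tolerance T -> representable T.
Proof.
move=> [joinA joinC joinxx] meet_joinl meet_joinr le_comp T [Trefl Tsym Tcomp].
exists (fun x z => join_le (term_op2 tjoin) x z /\ T x z); split.
- exact: compatible_inter.
- by move=> x; split; [apply: joinxx | apply: Trefl].
move=> x y; split=> [Txy | [z [[le_xz Txz] [le_yz Tyz]]]].
  exists (term_op2 tjoin x y); split; split.
  + by rewrite /join_le joinA joinxx.
  + by rewrite -{1}[x]joinxx; apply: compatible_term_op2.
  + by rewrite /join_le joinC -joinA joinxx.
  + rewrite -{1}[y]joinxx; apply: compatible_term_op2 => //.
    exact: Tsym.
have <- : term_op2 tmeet x z = x by rewrite -{1}le_xz meet_joinl.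
have <- : term_op2 tmeet z y = y by rewrite -{1}le_yz joinC meet_joinr.
by apply: compatible_term_op2 => //; apply: Tsym.
Qed.

Definition lattice_term (f : lattice_signature) : term lattice_signature 2 :=
  @App lattice_signature 2 f (@Var lattice_signature 2).

Section LatticeAlgebra.

Variables (L : Type) (join meet : L -> L -> L).

Lemma term_op2_join (a b : lattice_algebra join meet) :
  term_op2 (lattice_term Join) a b = join a b.
Proof. by rewrite /term_op2 /= !ffunE !(tnth_nth a). Qed.

Lemma term_op2_meet (a b : lattice_algebra join meet) :
  term_op2 (lattice_term Meet) a b = meet a b.
Proof. by rewrite /term_op2 /= !ffunE !(tnth_nth a). Qed.

Hypothesis lattL : is_lattice join meet.

Lemma lattice_joinxx : idempotent_op join.
Proof. by case: lattL => _ _ joinKI meetKU a; rewrite -{2}(meetKU a a) joinKI. Qed.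

(** The absorption laws make the order defined from the join coincide with the
    one defined from the meet, from which monotonicity of the meet is read off
    in the same way as that of the join. *)
Lemma join_le_meet (a b : L) : join_le join a b <-> meet a b = a.
Proof.
case: lattL => -[_ joinC] [_ meetC] joinKI meetKU.
by split=> [<- // | <-]; rewrite /join_le joinC meetC joinKI.
Qed.

Lemma lattice_le_compatible :
  compatible (A := lattice_algebra join meet) (join_le join).
Proof.
case: (lattL) => -[joinA joinC] [meetA meetC] _ _ f x y le_xy.
case: f x y le_xy => x y le_xy /=.
  have := le_xy ord0; have := le_xy ord_max; rewrite /join_le => le1 le0.
  by rewrite -joinA [join (x ord_max) _]joinC -joinA [join (y ord_max) _]joinC
     le1 joinA le0.
have /join_le_meet le0 := le_xy ord0; have /join_le_meet le1 := le_xy ord_max.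
apply/join_le_meet.
by rewrite -meetA [meet (x ord_max) _]meetC -meetA [meet (y ord_max) _]meetC
   le1 meetA le0.
Qed.

Lemma lattice_tolerance_representable
    (T : relation (lattice_algebra join meet)) :
  tolerance T -> representable T.
Proof.
case: (lattL) => -[joinA joinC] [_ meetC] _ meetKU.
apply: (@tolerance_representable _ _ (lattice_term Join) (lattice_term Meet)).
- split=> [a b c | a b | a]; rewrite !term_op2_join //.
  exact: lattice_joinxx.
- by move=> a b; rewrite term_op2_join term_op2_meet meetKU.
- by move=> a b; rewrite term_op2_join term_op2_meet joinC meetC meetKU.
move=> f x y le_xy; rewrite /join_le term_op2_join.
apply: lattice_le_compatible => i.
by rewrite /join_le -[RHS](le_xy i) term_op2_join.
Qed.

End LatticeAlgebra.

Theorem proposition5 :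
  (forall (S : signature) (A : algebra S) (tjoin tmeet : term S 2),
     semilattice_op (term_op2 (A := A) tjoin) ->
     (forall a b : A, term_op2 tmeet a (term_op2 tjoin a b) = a) ->
     (forall a b : A, term_op2 tmeet (term_op2 tjoin a b) b = b) ->
     compatible (join_le (term_op2 (A := A) tjoin)) ->
     forall T : relation A, tolerance T -> representable T)
  /\
  (forall (L : Type) (join meet : L -> L -> L),
     is_lattice join meet ->
     forall T : relation (lattice_algebra join meet),
       tolerance T -> representable T).
Proof.
split; first exact: tolerance_representable.
by move=> L join meet lattL T; apply: lattice_tolerance_representable.
Qed.
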